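(* Let $X$ be a Tychonoff paracompact $\sigma$-space. If $X$ is a $k$-space, then the following statements are equivalent: (1) the tightness of $V(X)$ is countable; (2) the tightness of $\mathrm{sp}_{4}(X)$ is countable; (3) $X$ is separable.
   Context: All vector spaces are over $\mathbb{R}$. For a Tychonoff space $X$, the free topological vector space $V(X)$ is a topological vector space together with a continuous map $i: X\to V(X)$ such that every continuous map $f$ from $X$ to a topological vector space $E$ gives rise to a unique continuous linear operator $\overline{f}: V(X)\to E$ with $f=\overline{f}\circ i$. The space $X$ is identified with $i(X)$, which is a Hamel basis of $V(X)$. For $n\in\mathbb{N}$ (positive integers), $\mathrm{sp}_n(X)=\{\lambda_1x_1+\cdots+\lambda_nx_n:\lambda_i\in[-n,n],\ x_i\in X,\ i=1,\dots,n\}\subseteq V(X)$, with the subspace topology. A family $\mathscr{P}$ of subsets of $X$ is a network of $X$ if whenever $x\in U$ with $U$ open in $X$, there is $P\in\mathscr{P}$ with $x\in P\subseteq U$. A regular space is a $\sigma$-space if it has a $\sigma$-locally finite network. A space $Y$ is a $k$-space if a subset $C\subseteq Y$ is closed in $Y$ whenever $C\cap K$ is closed in $K$ for each compact $K\subseteq Y$. A space $Y$ has countable tightness if the closure of any $A\subseteq Y$ equals the union of the closures of all countable subsets of $A$. *)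

(* Defs.v *)
From HB Require Import structures.
From mathcomp Require Import all_boot all_order all_algebra.
From mathcomp Require Import all_classical all_reals all_analysis.

Set Implicit Arguments.
Unset Strict Implicit.
Unset Printing Implicit Defensive.

Import Order.TTheory GRing.Theory Num.Theory.
Import numFieldNormedType.Exports.

Local Open Scope classical_set_scope.
Local Open Scope ring_scope.

Section TopologicalNotions.
Variable X : topologicalType.
Implicit Types P Q : set (set X).

Definition tychonoff_space := completely_regular_space X /\ hausdorff_space X.

Definition locally_finite P :=
  forall x : X, exists2 U, nbhs x U &
    finite_set [set A | P A /\ A `&` U !=set0].

Definition network P :=
  forall (x : X) (U : set X), open U -> U x ->
    exists A, [/\ P A, A x & A `<=` U].

Definition sigma_space :=
  regular_space X /\
  exists P_ : nat -> set (set X),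
    (forall n, locally_finite (P_ n)) /\ network (\bigcup_n P_ n).

Definition open_covering P :=
  (forall A, P A -> open A) /\ \bigcup_(A in P) A = [set: X].

Definition refines Q P := forall B, Q B -> exists2 A, P A & B `<=` A.

Definition paracompact_space :=
  forall P, open_covering P ->
    exists Q, [/\ open_covering Q, refines Q P & locally_finite Q].

(* [set_val @^-1` C] is [C `&` K] seen as a subset of the subspace [K]
   ([set_type K] with the initial topology of the inclusion). *)
Definition k_space :=
  forall C : set X,
    (forall K : set X, compact K -> closed ((set_val : K -> X) @^-1` C)) ->
    closed C.

Definition countably_tight :=
  forall A : set X,
    closure A = \bigcup_(B in [set B | B `<=` A /\ countable B]) closure B.

Definition separable_space := exists2 D : set X, countable D & dense D.

End TopologicalNotions.

(* [topologicalLmodType R] is the type of arbitrary topological vector spaces;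
   [tvsType R] would impose local convexity. *)
Definition free_tvs (R : realType) (X : topologicalType)
    (V : topologicalLmodType R) (i : X -> V) :=
  continuous i /\
  forall (E : topologicalLmodType R) (f : X -> E), continuous f ->
    exists! g : V -> E, [/\ linear g, continuous g & f = g \o i].

Definition sp (R : realType) (X : topologicalType)
    (V : topologicalLmodType R) (i : X -> V) (n : nat) : set V :=
  [set v | exists (l : 'I_n -> R) (x : 'I_n -> X),
    (forall k, - n%:R <= l k <= n%:R) /\ v = \sum_(k < n) l k *: i (x k)].

(* Main.v *)
(* Both tightness of V(X) and separability are governed by whether every locally
   finite family of nonempty open sets in X is countable.  If so, paracompactness makes
   all locally finite families countable, the sigma-locally finite network becomes
   countable, X is separable, and finite sums of products of network members with
   intervals form a countable network of V(X), which is therefore countably tight.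
   Conversely, an uncountable family yields a subset of sp_2(X) that accumulates at 0
   although none of its countable subsets does. *)

From HB Require Import structures.
Require Import Defs.
From mathcomp Require Import all_boot all_order all_algebra.
From mathcomp Require Import all_classical all_reals all_analysis.

Set Implicit Arguments.
Unset Strict Implicit.
Unset Printing Implicit Defensive.

Import Order.TTheory GRing.Theory Num.Theory.
Import numFieldNormedType.Exports.

Local Open Scope classical_set_scope.
Local Open Scope ring_scope.

(** * Locally finite families, countable networks and tightness *)

Lemma countable_enum (T : pointedType) (A : set T) :
  countable A -> exists f : nat -> T, A `<=` range f.
Proof. by move=> /pcard_geP/surjPex. Qed.

Section CountabilityOfLocallyFiniteFamilies.
Variable X : topologicalType.
Implicit Types P Q : set (set X).

Definition nonempty_members P := [set A | P A /\ A !=set0].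

Definition open_families_countable := forall Q, locally_finite Q ->
  Q `<=` open -> countable (nonempty_members Q).

(** Each nonempty open member meets a countable dense set, and each point of that set lies in only
    finitely many members. *)
Lemma separable_open_families_countable :
  separable_space X -> open_families_countable.
Proof.
move=> [D cD dD] Q lfQ oQ.
apply: (@sub_countable _ _ _ (\bigcup_(d in D) [set A | Q A /\ A d])).
  apply: subset_card_le => A [QA A0].
  by have [d [Ad Dd]] := dD _ A0 (oQ _ QA); exists d.
apply: bigcup_countable => // d _; apply: finite_set_countable.
have [U Ud] := lfQ d; apply: sub_finite_set => A [QA Ad]; split => //.
by exists d; split => //; exact: nbhs_singleton.
Qed.

(** Cover [X] by open sets meeting finitely many members of [P]. A locally finite open refinement
    has countably many nonempty members, each still meeting finitely many members of [P]. *)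
Lemma paracompact_families_countable : paracompact_space X ->
  open_families_countable ->
  forall P, locally_finite P -> countable (nonempty_members P).
Proof.
move=> pX cX P lfP.
pose meets U := [set A | P A /\ A `&` U !=set0].
have [] := pX [set U | open U /\ finite_set (meets U)].
  split; first by move=> U [].
  apply/seteqP; split => // x _; have [U + fU] := lfP x.
  rewrite nbhsE => -[U' [oU' U'x] U'U]; exists U' => //; split => //.
  apply: sub_finite_set fU => A [PA [y [Ay /U'U Uy]]]; split => //.
  by exists y.
move=> Q [[oQ cQ] refQ lfQ].
apply: (@sub_countable _ _ _ (\bigcup_(U in nonempty_members Q) meets U)).
  apply: subset_card_le => A [PA [x Ax]].
  have : [set: X] x by [].
  rewrite -cQ => -[U QU Ux]; exists U; first by split => //; exists x.
  by split => //; exists x.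
apply: bigcup_countable => [|U [QU _]]; first exact: cX.
apply: finite_set_countable; have [U' [_ fU'] UU'] := refQ _ QU.
by apply: sub_finite_set fU' => A [PA [y [Ay /UU' U'y]]]; split => //; exists y.
Qed.

Lemma sigma_space_network : sigma_space X ->
  (forall P, locally_finite P -> countable (nonempty_members P)) ->
  exists N : nat -> set X, network (range N).
Proof.
move=> [_ [P_ [lfP netP]]] cX.
have : countable (\bigcup_n nonempty_members (P_ n)).
  by apply: bigcup_countable => // n _; exact: cX.
move=> /countable_enum[N PN]; exists N => x U oU Ux.
have [A [[n _ PA] Ax AU]] := netP _ _ oU Ux; exists A; split => //.
by apply: PN; exists n => //; split => //; exists x.
Qed.

Lemma network_separable (N : nat -> set X) :
  network (range N) -> separable_space X.
Proof.
move=> netN; have [[p _]|noX] := pselect ([set: X] !=set0); last first.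
  by exists set0 => // O [x]; case: noX; exists x.
exists (range (fun n => xget p (N n))); first exact: card_image_le.
move=> O [x Ox] oO; have [_ [[n _ <-] Nx NO]] := netN _ _ oO Ox.
exists (xget p (N n)); split; last by exists n.
by apply: NO; exact: (xgetPex p (ex_intro (N n) x Nx)).
Qed.

(** One point of [A] chosen in each network set that meets [A] gives a countable set with the same
    closure as [A]. *)
Lemma network_countably_tight (N : nat -> set X) :
  network (range N) -> countably_tight X.
Proof.
move=> netN A; apply/seteqP; split => [x Ax|x [B [BA _]]]; last exact: closureS.
pose y n := xget x (A `&` N n).
exists (y @` [set n | A `&` N n !=set0]); first split.
- by move=> _ [n /(xgetPex x)[Ay _] <-].
- exact: card_le_trans (card_image_le _ _) (countableP _).
move=> U; rewrite nbhsE => -[V [oV Vx] VU].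
have [z [Az Vz]] := Ax _ (open_nbhs_nbhs (conj oV Vx)).
have [_ [[n _ <-] Nz NV]] := netN _ _ oV Vz.
have AN : A `&` N n !=set0 by exists z.
exists (y n); split; first by exists n.
by have [_ /NV/VU] := xgetPex x AN.
Qed.

End CountabilityOfLocallyFiniteFamilies.

Lemma countably_tight_set_type (X : topologicalType) (S : set X) :
  countably_tight X -> countably_tight (set_type S).
Proof.
move=> tX A; apply/seteqP; split => [x Ax|x [B [BA _]]]; last exact: closureS.
have : closure (val @` A) (val x).
  move=> U /(@initial_continuous S X set_val x) /Ax [y [Ay Uy]].
  by exists (val y); split => //; exists y.
rewrite tX => -[B [BA cB] Bx]; exists (A `&` val @^-1` B); first split.
- exact: subIsetl.
- apply: card_le_trans cB.
  (* [insubd x] inverts the inclusion, with default value [x] outside [S]. *)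
  apply: card_le_trans (card_image_le (insubd x) B).
  by apply: subset_card_le => y [_ By]; exists (val y) => //; exact: valKd.
move=> U [_ [[W oW <-]] Wx WU].
have [z [Bz Wz]] := Bx _ (open_nbhs_nbhs (conj oW Wx)).
have [y Ay yz] := BA _ Bz.
by exists y; split; [split => //=; rewrite yz|apply: WU; rewrite /= set_valE yz].
Qed.

(** * Linear subspaces as topological vector spaces *)

Section SubTvs.
Variables (R : numDomainType) (V : topologicalLmodType R) (S : submodClosed V).

(** Made a type of its own so that the universal property of the free space can be applied with a
    subspace as target. *)
Definition sub_tvs := {v : V | v \in S}.

HB.instance Definition _ := SubChoice.on sub_tvs.
HB.instance Definition _ := [SubChoice_isSubLmodule of sub_tvs by <:].
HB.instance Definition _ :=
  Topological.copy sub_tvs (initial_topology (val : sub_tvs -> V)).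

Lemma sub_tvs_val_continuous : continuous (val : sub_tvs -> V).
Proof. exact: initial_continuous. Qed.

Lemma continuous_to_sub_tvs (T : topologicalType) (f : T -> sub_tvs) :
  continuous (val \o f) -> continuous f.
Proof. exact: (@continuous_comp_initial _ _ _ (val : sub_tvs -> V)). Qed.

Lemma sub_tvs_add_continuous :
  continuous (fun x : sub_tvs * sub_tvs => x.1 + x.2).
Proof.
apply: continuous_to_sub_tvs => -[x y].
apply: (@continuous2_cvg _ _ _ _ _ _ _ _ (fun u v : V => u + v)
  (val x) (val y)).
- exact: (@add_continuous V (val x, val y)).
- by apply: (@cvg_comp _ _ _ fst val _ (nbhs x) _ cvg_fst);
  exact: sub_tvs_val_continuous.
- by apply: (@cvg_comp _ _ _ snd val _ (nbhs y) _ cvg_snd);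
  exact: sub_tvs_val_continuous.
Qed.

HB.instance Definition _ :=
  PreTopologicalNmodule_isTopologicalNmodule.Build sub_tvs sub_tvs_add_continuous.

Lemma sub_tvs_scale_continuous :
  continuous (fun z : R^o * sub_tvs => z.1 *: z.2).
Proof.
apply: continuous_to_sub_tvs => -[a x].
apply: (@continuous2_cvg _ _ _ _ _ _ _ _ (fun (b : R^o) (v : V) => b *: v)
  a (val x)).
- exact: (@scale_continuous R V (a, val x)).
- exact: cvg_fst.
- by apply: (@cvg_comp _ _ _ snd val _ (nbhs x) _ cvg_snd);
  exact: sub_tvs_val_continuous.
Qed.

HB.instance Definition _ :=
  TopologicalNmodule_isTopologicalLmodule.Build R sub_tvs sub_tvs_scale_continuous.

End SubTvs.

(** * The span of the generators *)

Section Combinations.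
Variables (R : numDomainType) (X : Type) (V : lmodType R) (i : X -> V).

Definition combination (s : seq (R * X)) : V := \sum_(p <- s) p.1 *: i p.2.

Definition combinations : {pred V} :=
  fun v => `[< exists s, v = combination s >].

Lemma combinations_submod_closed : submod_closed combinations.
Proof.
split=> [|a _ _ /asboolP[s ->] /asboolP[t ->]]; apply/asboolP.
  by exists [::]; rewrite /combination big_nil.
exists ([seq (a * p.1, p.2) | p <- s] ++ t).
rewrite /combination big_cat big_map scaler_sumr; congr (_ + _).
by apply: eq_bigr => p _; rewrite scalerA.
Qed.

HB.instance Definition _ :=
  GRing.isSubmodClosed.Build R V combinations combinations_submod_closed.

Lemma combinations_gen x : i x \in combinations.
Proof.
apply/asboolP; exists [:: (1, x)].
by rewrite /combination big_seq1 scale1r.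
Qed.

End Combinations.

(* A continuous linear retraction of [V] onto the span of [i X], composed with the
   inclusion, agrees with the identity on [i X]. *)
Lemma free_tvs_combination (R : realType) (X : topologicalType)
    (V : topologicalLmodType R) (i : X -> V) :
  free_tvs i -> forall v, exists s, v = combination i s.
Proof.
move=> [ci univ] v.
pose W : topologicalLmodType R := sub_tvs (combinations i).
pose f x : W := exist _ (i x) (combinations_gen i x).
have cf : continuous f := @continuous_to_sub_tvs _ _ _ _ f ci.
have [g [[ling cg fE] _]] := univ W f cf.
have [k [_ kuniq]] := univ V i ci.
have gE : val \o g = id.
  rewrite -(kuniq id); last by split=> // x; exact: cvg_id.
  apply/esym/kuniq; split.
  - by move=> a x y; rewrite /= ling.
  - move=> x; apply: continuous_comp; [exact: cg|exact: sub_tvs_val_continuous].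
  - by rewrite -compA -fE.
by have := valP (g v); rewrite -[val (g v)]/((val \o g) v) gE => /asboolP.
Qed.

(** * A countable network of linear combinations *)

Section NetworkOfCombinations.
Variables (R : realType) (X : topologicalType) (V : topologicalLmodType R).
Variables (i : X -> V) (ci : continuous i).

Lemma real_network : exists N : nat -> set R, network (range N).
Proof.
have [N rN] := countable_enum
  (card_le_trans (card_image_le (fun p : rat * rat =>
     `]ratr p.1 : R, ratr p.2[%classic) setT) (countableP setT)).
exists N => x U oU Ux.
have [e /= e0 eU] := (nbhs_ballP _ _).1 (open_nbhs_nbhs (conj oU Ux)).
have [p] : exists p : rat, ratr p \in `]x - e, x[.
  by apply: rat_in_itvoo; rewrite ltrBlDr ltrDl.
have [q] : exists q : rat, ratr q \in `]x, x + e[.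
  by apply: rat_in_itvoo; rewrite ltrDl.
rewrite !in_itv /= => /andP[xq qe] /andP[ep px].
exists `]ratr p, ratr q[%classic; split.
- by apply: rN; exists (p, q).
- by rewrite /= in_itv /= px.
- move=> y /=; rewrite in_itv /= => /andP[py yq]; apply: eU.
  by rewrite /ball /= ltr_distlC (lt_trans ep py) (lt_trans yq qe).
Qed.

(** This is the Minkowski sum, over the pairs [(B, C)] of the list, of the sets of products of
    scalars in [B] with images of points of [C]. *)
Fixpoint combination_set (s : seq (set R * set X)) : set V :=
  if s is p :: s' then
    [set v | exists l x w,
      [/\ p.1 l, p.2 x, combination_set s' w & v = l *: i x + w]]
  else [set 0].

(** Induction on the length: continuity of addition splits off the head term, and continuity of
    scaling and of [i] places its coefficient and its point in network sets. *)
Lemma combination_set_network (N : nat -> set R) (M : nat -> set X) :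
    network (range N) -> network (range M) ->
  forall (s : seq (R * X)) (U : set V), open U -> U (combination i s) ->
  exists t : seq (nat * nat),
    let A := combination_set [seq (N p.1, M p.2) | p <- t] in
    A (combination i s) /\ A `<=` U.
Proof.
move=> netN netM; elim=> [U oU|[l x] s IHs U oU].
  by rewrite /combination big_nil => U0; exists [::]; split => //= _ ->.
rewrite /combination big_cons /= -/(combination i s) => Uv.
have [[/= B C] [nB nC] BCU] :=
  @add_continuous V (l *: i x, combination i s) U (open_nbhs_nbhs (conj oU Uv)).
have [[/= D E] [nD nE] DEB] := @scale_continuous R V (l, i x) B nB.
move: nC; rewrite nbhsE => -[C' [oC' C's] C'C].
move: nD; rewrite nbhsE => -[D' [oD' D'l] D'D].
have := ci nE; rewrite nbhs_simpl nbhsE => -[E' [oE' E'x] E'E].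
have [t [ts tC]] := IHs _ oC' C's.
have [_ [[m _ <-] Nl ND]] := netN _ _ oD' D'l.
have [_ [[n _ <-] Mx ME]] := netM _ _ oE' E'x.
exists ((m, n) :: t); split; first by exists l, x, (combination i s).
move=> _ [/= k [y [w [Nk My tw ->]]]].
apply: (BCU (_, _)); split => /=; last exact/C'C/tC.
by apply: (DEB (_, _)); split => /=; [exact/D'D/ND|exact/E'E/ME].
Qed.

(** There are only countably many finite lists of pairs of indices, and the sets they code form the
    network. *)
Lemma combination_network (M : nat -> set X) : network (range M) ->
  (forall v, exists s, v = combination i s) ->
  exists N : nat -> set V, network (range N).
Proof.
move=> netM gen; have [N netN] := real_network.
have [K rK] := countable_enum
  (card_le_trans (card_image_le (fun t : seq (nat * nat) =>
     combination_set [seq (N p.1, M p.2) | p <- t]) setT) (countableP setT)).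
exists K => v U oU Uv; have [s vE] := gen v; move: Uv; rewrite vE => Uv.
have [t [tv tU]] := combination_set_network netN netM oU Uv.
by exists (combination_set [seq (N p.1, M p.2) | p <- t]); split => //;
  apply: rK; exists t.
Qed.

End NetworkOfCombinations.

(** * Real labels on uncountable sets, and sums of bump functions *)

Lemma uncountable_reals (R : realType) : ~ countable [set: R].
Proof.
move=> /(sub_countable (subset_card_le (@subsetT _ `[0, 1]%classic))).
move=> /countable_lebesgue_measure0 /eqP.
by rewrite lebesgue_measure_itv /= lte_fin ltr01 oppr0 adde0 eqe oner_eq0.
Qed.

(* A maximal injective partial function either is total on [P] or is onto [R]. *)
Lemma uncountable_injection (R : realType) (T : Type) (P : set T) :
  ~ countable P ->
  exists (Q : set T) (r : T -> R),
    [/\ Q `<=` P, ~ countable Q & {in Q &, injective r}].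
Proof.
move=> ncP.
pose partial_inj (G : set (T * R)) :=
  [/\ forall p, G p -> P p.1,
      forall p q, G p -> G q -> p.1 = q.1 -> p = q &
      forall p q, G p -> G q -> p.2 = q.2 -> p = q].
have [|G [[GP Gfun Ginj] Gmax]] := @Zorn_bigcup _ partial_inj.
  move=> F FP Ftot; split.
  - by move=> p [G /FP[GP _ _] /GP].
  - move=> p q [G FG Gp] [H FH Hq]; have [GH|HG] := Ftot _ _ FG FH.
      by have [_ Hfun _] := FP _ FH; apply: Hfun => //; exact: GH.
    by have [_ Gfun _] := FP _ FG; apply: Gfun => //; exact: HG.
  - move=> p q [G FG Gp] [H FH Hq]; have [GH|HG] := Ftot _ _ FG FH.
      by have [_ _ Hinj] := FP _ FH; apply: Hinj => //; exact: GH.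
    by have [_ _ Ginj] := FP _ FG; apply: Ginj => //; exact: HG.
pose Q := fst @` G; pose r t : R := xget 0 [set s | G (t, s)].
have Gr t : Q t -> G (t, r t).
  by move=> [[t' s] Gts <-]; apply: (@xgetPex _ 0 [set s | G (t', s)]); exists s.
exists Q, r; split.
- by move=> _ [p Gp <-]; exact: GP.
- move=> cQ.
  have [t Pt Qt] : exists2 t, P t & ~ Q t.
    apply: contrapT => /forall2NP PQ; apply: ncP.
    apply: sub_countable cQ; apply: subset_card_le => t Pt.
    by have [//|/contrapT] := PQ t.
  have cG : countable (snd @` G).
    apply: sub_countable cQ; apply: card_le_trans (card_image_le r Q).
    apply: subset_card_le => _ [[t' s] Gp <-]; have Qt' : Q t' by exists (t', s).
    by exists t' => //=; have [] := Gfun _ _ (Gr _ Qt') Gp erefl.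
  have [s Gs] : exists s, ~ (snd @` G) s.
    apply: contrapT => /forallNP Gs; apply: (@uncountable_reals R).
    by apply: sub_countable cG; apply: subset_card_le => s _; exact: contrapT (Gs s).
  apply: (Gmax ((t, s) |` G)).
    split; first by move=> p; right.
    by move=> /(_ (t, s) (or_introl erefl)) Gts; apply: Qt; exists (t, s).
  split.
  - by move=> p [->//|/GP].
  - move=> p q [->|Gp] [->|Gq] //=.
    + by move=> tq; case: Qt; exists q.
    + by move=> pt; case: Qt; exists p.
    + exact: Gfun.
  - move=> p q [->|Gp] [->|Gq] //=.
    + by move=> sq; case: Gs; exists q.
    + by move=> ps; case: Gs; exists p.
    + exact: Ginj.
- move=> t u /set_mem/Gr Gt /set_mem/Gr Gu rtu.
  by have [] := Ginj _ _ Gt Gu rtu.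
Qed.

(** Countably many half-open intervals of length [e] cover the reals. Without close labels, the
    index of the interval containing [r x] would be injective on [Q]. *)
Lemma uncountable_close (R : realType) (T : Type) (Q : set T) (r : T -> R)
    (e : R) :
  ~ countable Q -> 0 < e ->
  exists x y, [/\ Q x, Q y, x <> y & `|r x - r y| < e].
Proof.
move=> ncQ e0; apply: contrapT => noclose; apply: ncQ.
apply/countable_injP; exists (fun x => pickle (Num.floor (r x / e))).
move=> x y /set_mem Qx /set_mem Qy /(pcan_inj pickleK) xy.
apply: contrapT => nxy; apply: noclose; exists x, y; split => //.
have fx := floor_itv (r x / e); have fy := floor_itv (r y / e).
move: fx fy; rewrite xy; set k := Num.floor _.
rewrite intrD !ler_pdivlMr// !ltr_pdivrMr// mulrDl mul1r.
move=> /andP[x1 x2] /andP[y1 y2].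
rewrite ltr_distlC; apply/andP; split.
  by rewrite ltrBlDr (lt_le_trans x2)// lerD2r.
by rewrite (lt_le_trans y2)// lerD2r.
Qed.

(** Add bumps at the points [x A], each vanishing off [A] and scaled by [M A]. The sum is locally
    finite, hence continuous, and at [x A] the term of [A] alone contributes [M A]. *)
Lemma locally_finite_bump_sum (R : realType) (X : topologicalType)
    (P : set (set X)) (x : set X -> X) (M : set X -> R) :
    completely_regular_space X -> locally_finite P -> P `<=` open ->
    (forall A, P A -> A (x A)) -> (forall A, 0 <= M A) ->
  exists h : X -> R, [/\ continuous h, forall y, 0 <= h y &
    forall A, P A -> M A <= h (x A)].
Proof.
move=> crX lfP oP Px M0.
have /choice[f fP] A : exists f : X -> R, P A ->
    [/\ continuous f, forall y, 0 <= f y, f (x A) = 1 &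
        forall y, ~ A y -> f y = 0].
  have [PA|] := pselect (P A); last by exists (fun=> 0).
  (* The separating function is 0 at [x A] and 1 off [A], so the bump is [1 - g]. *)
  have /(uniform_separatorP (R := R))[g [cg g01 gx gA]] :=
    crX (x A) (~` A) (open_closedC (oP _ PA)) (fun nAx => nAx (Px _ PA)).
  exists (fun y => 1 - g y) => _; split.
  - by move=> y; apply: cvgB; [exact: cvg_cst|exact: cg].
  - move=> y; rewrite subr_ge0; have : `[0, 1]%classic (g y) by apply: g01; exists y.
    by rewrite /= in_itv /= => /andP[].
  - by rewrite (_ : g (x A) = 0) ?subr0//; apply: gx; exists (x A).
  - by move=> y nAy; rewrite (_ : g y = 1) ?subrr//; apply: gA; exists y.
pose h y := \sum_(A \in P) M A * f A y.
have f_ge0 y A : P A -> 0 <= M A * f A y.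
  by move=> /fP[_ f0 _ _]; rewrite mulr_ge0.
(* At points of [N] only members meeting [N] contribute; for a suitable neighbourhood [N] this is
   one fixed finite sum. *)
have hE y (N : set X) : N y ->
    h y = \sum_(A \in [set A | P A /\ A `&` N !=set0]) M A * f A y.
  move=> Ny; apply/esym/fsbig_widen => [A []//|A [PA nAN]] /=.
  have [_ _ _ ->] := fP _ PA; first by rewrite mulr0.
  by move=> Ay; apply: nAN; split => //; exists y.
exists h; split.
- move=> y; have [N yN fN] := lfP y.
  pose s := finmap.enum_fset (fset_set [set A | P A /\ A `&` N !=set0]).
  have hs z : N z -> h z = \sum_(A <- s | A \in s) M A * f A z.
    by move=> Nz; rewrite (hE _ _ Nz) fsbig_finite// -big_seq.
  rewrite /continuous_at (hs _ (nbhs_singleton yN)).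
  apply: (@cvg_trans _ ((fun z => \sum_(A <- s | A \in s) M A * f A z) @ y)).
    by apply: near_eq_cvg; near=> z; apply/esym/hs; near: z.
  apply: cvg_big => [|A]; first exact: add_continuous.
  rewrite in_fset_set// => /set_mem[/fP[cf _ _ _] _].
  by apply: cvgM; [exact: cvg_cst|exact: cf].
- by move=> y; apply: fsumr_ge0 => A; exact: f_ge0.
- move=> A PA; have [N yN fN] := lfP (x A).
  have AN : P A /\ A `&` N !=set0.
    by split => //; exists (x A); split; [exact: Px|exact: nbhs_singleton].
  rewrite (hE _ _ (nbhs_singleton yN)) (fsbigD1 A)//=.
  have [_ _ -> _] := fP _ PA; rewrite mulr1 lerDl.
  by apply: fsumr_ge0 => B [[PB _] _]; exact: f_ge0.
Unshelve. all: by end_near. Qed.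

(** * From tightness of [sp i 4] to countable open families *)

Section FreeTvs.
Variables (R : realType) (X : topologicalType) (V : topologicalLmodType R).
Variables (i : X -> V) (freeV : free_tvs i).

Lemma two_term_sp (l m : R) (x y : X) :
  `|l| <= 4 -> `|m| <= 4 -> sp i 4 (l *: i x + m *: i y).
Proof.
rewrite !ler_norml => l4 m4.
(* Two zero coefficients, placed at [y], pad the sum to four terms. *)
exists (nth 0 [:: l; m]), (fun k : 'I_4 => if k == ord0 then x else y).
split.
  by case=> -[|[|[|[|]]]] //= _; rewrite -?ler_norml ?normr0 ?ler0n ?ler_norml.
by rewrite !big_ord_recl big_ord0 /= !scale0r !addr0.
Qed.

(** The bound on each coefficient depends only on its own point and is coded by an integer, which
    prepares a pigeonhole argument over uncountably many points. *)
Lemma near0_two_term (W : set V) : nbhs 0 W -> exists n : X -> nat,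
  forall (x y : X) (l m : R), `|l| < (n x).+1%:R^-1 -> `|m| < (n y).+1%:R^-1 ->
  W (l *: i x + m *: i y).
Proof.
move=> W0.
have := @add_continuous V (0, 0) W; rewrite /= addr0 => /(_ W0).
move=> [[/= A B] [nA nB] ABW].
have /choice[n nP] x : exists n : nat, forall l : R, `|l| < n.+1%:R^-1 ->
    (A `&` B) (l *: i x).
  have : nbhs (0 *: i x) (A `&` B) by rewrite scale0r; exact: filterI.
  move=> /(@scale_continuous R V (0, i x))[[/= C D] [nC nD] CDAB].
  have [e /= e0 eC] := (nbhs_ballP _ _).1 nC.
  have [n _ ne] := near_infty_natSinv_lt (PosNum e0).
  exists n => l ln; apply: (CDAB (l, i x)); split => /=; last exact: nbhs_singleton.
  apply: eC; rewrite /ball /= sub0r normrN.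
  by apply: lt_trans ln _; exact: (ne n (leqnn n)).
exists n => x y l m /nP[Al _] /nP[_ Bm].
exact: (ABW (_, _)).
Qed.

(** The linear extension [g] of [h] is continuous, so the condition [g < g u + 1] defines a
    neighbourhood of [u]. A set on which it fails cannot accumulate at [u]. *)
Lemma closure_linear_extension (S : set (sp i 4)) (u : sp i 4) :
  closure S u -> forall h : X -> R, continuous h ->
  exists g : V -> R, [/\ linear (g : V -> R^o), forall x, g (i x) = h x &
    exists2 v, S v & g (val v) < g (val u) + 1].
Proof.
move=> Su h ch; have [g [[ling cg gE] _]] := freeV.2 (R : topologicalLmodType R) h ch.
exists g; split => //; first by move=> x; rewrite gE.
have /cg : nbhs (g (val u)) [set t : R | t < g (val u) + 1].
  by apply: lt_nbhsl; rewrite ltrDl.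
move=> /(@initial_continuous (sp i 4) V set_val u).
by move=> /Su[v [Sv vu]]; exists v.
Qed.

(* If [P] is an uncountable locally finite family of nonempty open sets, label
   uncountably many of its members injectively by reals.  The points
   [|r A - r B| (x_A + x_B)] with [x_A \in A] accumulate at 0, since uncountably many
   reals contain arbitrarily close pairs.  Countably many of them do not: some
   continuous [h >= 0] grows along the [x_A] fast enough that its linear extension is
   at least 1 on all of them. *)
Lemma sp_tight_open_families_countable :
  completely_regular_space X -> countably_tight (set_type (sp i 4)) ->
  open_families_countable X.
Proof.
move=> crX tsp P lfP oP; apply: contrapT => ncP.
have [Q [r [QP ncQ injr]]] := uncountable_injection R ncP.
(* A default point for the choices below; an empty [X] would leave [Q] without members. *)
have [p _] : [set: X] !=set0.
  apply/set0P/eqP => X0; apply: ncQ.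
  apply: (@sub_countable _ _ _ set0) => //; apply: subset_card_le => A /QP.
  by move=> [_ [x _]]; have : [set: X] x by []; rewrite X0.
pose x A := xget p A.
have Qx A : Q A -> A (x A) by move=> /QP[_]; exact: xgetPex.
pose c A B := `|r A - r B|.
pose w A B := c A B *: i (x A) + c A B *: i (x B).
have cC A B : c A B = c B A by rewrite /c distrC.
have wC A B : w A B = w B A by rewrite /w cC addrC.
pose S : set (sp i 4) := [set u | exists A B,
  [/\ Q A, Q B, A <> B & val u = w A B]].
have sp0 : sp i 4 0.
  have := @two_term_sp 0 0 p p; rewrite !scale0r addr0; apply; by rewrite normr0.
pose o : sp i 4 := exist _ 0 (mem_set sp0).
have So : closure S o.
  move=> U [_ [[W oW <-]] W0 WU].
  have [n nP] := near0_two_term (open_nbhs_nbhs (conj oW W0)).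
  (* Pigeonhole: [n (x A)] takes one value [k] on uncountably many [A], two of which have labels
     closer than [k.+1%:R^-1]. *)
  have [k nck] : exists k, ~ countable [set A | Q A /\ n (x A) = k].
    apply: contrapT => /forallNP cQ; apply: ncQ.
    apply: (@sub_countable _ _ _ (\bigcup_k [set A | Q A /\ n (x A) = k])).
      by apply: subset_card_le => A QA; exists (n (x A)).
    by apply: bigcup_countable => // k _; exact: contrapT (cQ k).
  have k0 : 0 < k.+1%:R^-1 :> R by rewrite invr_gt0 ltr0n.
  have [A [B [[QA nA] [QB nB] AB cAB]]] := uncountable_close r nck k0.
  have c4 : `|c A B| <= 4.
    rewrite normr_id (le_trans (ltW cAB))//.
    by rewrite (@le_trans _ _ 1)// ?ler1n// invf_le1 ?ltr0n// ler1n.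
  exists (exist _ (w A B) (mem_set (two_term_sp (x A) (x B) c4 c4))).
  split; first by exists A, B.
  by apply: WU; apply: nP; rewrite ?nA ?nB normr_id.
move: So; rewrite tsp => -[S' [S'S cS'] S'o].
have /choice[a aP] u : exists ab : set X * set X, S' u ->
    [/\ Q ab.1, Q ab.2, ab.1 <> ab.2 & val u = w ab.1 ab.2].
  have [/S'S[A [B AB]]|] := pselect (S' u); first by exists (A, B).
  by exists (set0, set0).
(* [C] gathers the members of [Q] chosen to represent the points of [S']; they are numbered by [e],
   with partial inverse [D]. *)
pose C := (fst \o a) @` S' `|` (snd \o a) @` S'.
have /countable_injP[e einj] : countable C.
  rewrite /C -bigcup2E; apply: bigcup_countable => // -[|[|k]] _ //=.
  - exact: card_le_trans (card_image_le _ _) cS'.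
  - exact: card_le_trans (card_image_le _ _) cS'.
have CQ : C `<=` Q by move=> _ [] [u /aP[? ? _ _] <-].
pose D n := xget set0 [set A | C A /\ e A = n].
have DK A : C A -> D (e A) = A.
  move=> CA; have [] := @xgetPex _ set0 [set B | C B /\ e B = e A].
    by exists A.
  by move=> CB eBA; apply: einj => //; exact: mem_set.
(* Chosen to dominate [(c A B)^-1] for every [B] in [C] numbered before [A]; numbers not attained on
   [C] only add nonnegative terms. *)
pose M A := \sum_(n < e A) (c A (D n))^-1.
have [||A|h [ch h0 hM]] :=
  @locally_finite_bump_sum R X Q x M crX _ _ Qx.
- move=> y; have [U yU fU] := lfP y; exists U => //.
  by apply: sub_finite_set fU => A [/QP[PA _] ?].
- by move=> A /QP[/oP].
- by apply: sumr_ge0 => n _; rewrite invr_ge0 /c.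
have [g [ling gi [u S'u]]] := closure_linear_extension S'o ch.
have g0 : g 0 = 0 by have := ling (-1) 0 0; rewrite scaler0 addr0 scaleN1r addNr.
have gw A B : g (w A B) = c A B * (h (x A) + h (x B)).
  have gZ k v : g (k *: v) = k * g v by have := ling k v 0; rewrite !addr0 g0 addr0.
  by rewrite /w ling !gZ !gi mulrDr.
(* As [h] is nonnegative, the value is at least [c A B * M A], and one term of [M A] is
   [(c A B)^-1]. *)
have cM A B : C A -> C B -> (e B < e A)%N -> 1 <= g (w A B).
  move=> CA CB BA; have cAB : 0 < c A B.
    rewrite normr_gt0 subr_eq0; apply: contraTneq BA => /injr.
    by rewrite (mem_set (CQ _ CA)) (mem_set (CQ _ CB)) => ->//; rewrite ltnn.
  rewrite gw -ler_pdivrMl// mulr1 -[leLHS]addr0 lerD//.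
  apply: le_trans (hM _ (CQ _ CA)).
  rewrite /M (bigD1 (Ordinal BA))//= DK// lerDl.
  by apply: sumr_ge0 => n _; rewrite invr_ge0 /c.
have [Qa Qb ab ->] := aP _ S'u.
rewrite g0 add0r ltNge => /negP; apply.
have Ca : C (a u).1 by left; exists u.
have Cb : C (a u).2 by right; exists u.
(* By symmetry of [w] the pair can be ordered by number; equal numbers would make its members
   equal. *)
have [eab|eba|eab] := ltngtP (e (a u).1) (e (a u).2).
- by rewrite wC; exact: cM.
- exact: cM.
- by case: ab; rewrite -(DK _ Ca) eab DK.
Qed.

End FreeTvs.

Theorem theorem3p17 (R : realType) (X : topologicalType)
    (V : topologicalLmodType R) (i : X -> V)
    (tychonoffX : tychonoff_space X)
    (paracompactX : paracompact_space X)
    (sigmaX : sigma_space X)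
    (kX : k_space X)
    (freeV : free_tvs i) :
  [<-> countably_tight V;
       countably_tight (set_type (sp i 4));
       separable_space X].
Proof.
(* This network of [X] serves twice: it yields separability, and it generates a countable network of
   [V]. *)
have families_network : open_families_countable X ->
    exists N : nat -> set X, network (range N).
  by move=> /(paracompact_families_countable paracompactX);
    exact: sigma_space_network.
tfae.
- exact: countably_tight_set_type.
- move=> /(sp_tight_open_families_countable freeV tychonoffX.1) /families_network[N].
  exact: network_separable.
- move=> /separable_open_families_countable /families_network[M netM].
  have [N netN] :=
    combination_network freeV.1 netM (free_tvs_combination freeV).
  exact: network_countably_tight netN.
Qed.
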